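(* Let $n>64$ be an integer, set $l=8n$, $t=5n$, $c=4n$, and let $G=C_l\vee(S_t+K_c)$. Let $T_1=K_l\vee(S_t+K_c)$ be the triangulation of $G$ obtained by turning the vertex set of $C_l$ into a clique, and let $T_2=C_l^+\vee K_{t+c}$ be a triangulation of $G$ obtained by replacing $C_l$ by a minimal triangulation $C_l^+$ of $C_l$ and turning the vertex set of $S_t+K_c$ into a clique. Then, over the set of all triangulations of $G$, $T_1$ minimizes $\mathrm{nnz}$ but minimizes neither $\mathrm{flop}$ nor $\omega$, whereas $T_2$ minimizes both $\mathrm{flop}$ and $\omega$ but does not minimize $\mathrm{nnz}$. In particular, no triangulation of $G$ minimizes both $\mathrm{nnz}$ and $\mathrm{flop}$.
   Context: All graphs are finite, simple and undirected. For graphs $G_1=(V_1,E_1)$ and $G_2=(V_2,E_2)$ with disjoint vertex sets, $G_1+G_2=(V_1\cup V_2,E_1\cup E_2)$ is their sum and $G_1\vee G_2=(V_1\cup V_2,E_1\cup E_2\cup(V_1\times V_2))$ is their join. $C_l$ is the cycle on $l$ vertices, $K_s$ the complete graph on $s$ vertices, and $S_t$ the graph with $t$ vertices and no edges. A triangulation of a graph $G=(V,E)$ is a chordal graph $H=(V,E\cup F)$ with $F\subseteq V\times V$; it is minimal if no triangulation of $G$ has an edge set properly contained in that of $H$. A perfect elimination ordering (PEO) of a graph $H$ on $N$ vertices is a bijection $\alpha:V\to\{1,\dots,N\}$ such that for each $i$ the neighbors $w$ of $\alpha^{-1}(i)$ in $H$ with $\alpha(w)>i$ form a clique; $H$ is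 chordal if and only if it has a PEO. For a PEO $\alpha$ of $H$, the elimination degree $d(\alpha^{-1}(i))$ is the number of neighbors $w$ of $\alpha^{-1}(i)$ in $H$ with $\alpha(w)>i$. The multiset of elimination degrees is the same for all PEOs of $H$, so the following depend only on $H$ (for any PEO $\alpha$ of $H$): $$\mathrm{nnz}(H)=\sum_{i=1}^N (d(\alpha^{-1}(i))+1),\quad \mathrm{flop}(H)=\sum_{i=1}^N (d(\alpha^{-1}(i))+1)^2,\quad \omega(H)=\max_{1\le i\le N}(d(\alpha^{-1}(i))+1).$$ *)

(* Defs.v *)
From HB Require Import structures.
From mathcomp Require Import all_boot.

Set Implicit Arguments.
Unset Strict Implicit.
Unset Printing Implicit Defensive.

Record sgraph (V : finType) := SGraph {
  adj :> rel V;
  adj_sym : symmetric adj;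
  adj_irr : irreflexive adj
}.

Section Constructions.

Definition complete_rel (V : finType) : rel V := fun x y => x != y.

Lemma complete_sym V : symmetric (@complete_rel V).
Proof. by move=> x y; rewrite /complete_rel eq_sym. Qed.

Lemma complete_irr V : irreflexive (@complete_rel V).
Proof. by move=> x; rewrite /complete_rel eqxx. Qed.

Definition complete (V : finType) : sgraph V :=
  SGraph (@complete_sym V) (@complete_irr V).

Definition edgeless_rel (V : finType) : rel V := fun _ _ => false.

Lemma edgeless_sym V : symmetric (@edgeless_rel V).
Proof. by []. Qed.

Lemma edgeless_irr V : irreflexive (@edgeless_rel V).
Proof. by []. Qed.

Definition edgeless (V : finType) : sgraph V :=
  SGraph (@edgeless_sym V) (@edgeless_irr V).

(* [ordS] is the successor modulo l; this is the cycle C_l for l >= 3. *)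
Definition cycle_rel (l : nat) : rel 'I_l :=
  fun i j => (i != j) && ((j == ordS i) || (i == ordS j)).

Lemma cycle_rel_sym l : symmetric (@cycle_rel l).
Proof. by move=> i j; rewrite /cycle_rel eq_sym orbC. Qed.

Lemma cycle_rel_irr l : irreflexive (@cycle_rel l).
Proof. by move=> i; rewrite /cycle_rel eqxx. Qed.

Definition cycle_graph (l : nat) : sgraph 'I_l :=
  SGraph (@cycle_rel_sym l) (@cycle_rel_irr l).

Variables (V1 V2 : finType) (G1 : sgraph V1) (G2 : sgraph V2).

(* The disjoint union of the vertex sets is the sum type; [cross] tells whether
   all the edges between the two sides are present. *)
Definition glue_rel (cross : bool) : rel (V1 + V2) := fun u v =>
  match u, v with
  | inl x, inl y => G1 x y
  | inr x, inr y => G2 x y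
  | _, _ => cross
  end.

Lemma glue_sym cross : symmetric (glue_rel cross).
Proof. by move=> [x|x] [y|y] //=; apply: adj_sym. Qed.

Lemma glue_irr cross : irreflexive (glue_rel cross).
Proof. by move=> [x|x] /=; apply: adj_irr. Qed.

Definition gsum : sgraph (V1 + V2)%type :=
  SGraph (glue_sym false) (glue_irr false).

Definition gjoin : sgraph (V1 + V2)%type :=
  SGraph (glue_sym true) (glue_irr true).

End Constructions.

Section Triangulations.

Variable V : finType.
Implicit Types G H : sgraph V.

(* Every cycle on at least four vertices has a chord, i.e. an edge between two
   of its vertices that are not consecutive on it. *)
Definition chordal H : Prop :=
  forall s : seq V, ucycle H s -> 4 <= size s ->
  exists x y, [/\ x \in s, y \in s, H x y, y != next s x & x != next s y].

Definition triangulation G H : Prop := subrel G H /\ chordal H.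

Definition minimal_triangulation G H : Prop :=
  triangulation G H /\
  ~ (exists H', [/\ triangulation G H', subrel H' H & ~ subrel H H']).

(* Positions are numbered from 0. An injection into 'I_#|V| is a bijection. *)
Definition is_peo H (a : {ffun V -> 'I_#|V|}) : bool :=
  injectiveb a &&
  [forall v, forall w, forall x,
    [&& H v w, a v < a w, H v x, a v < a x & w != x] ==> H w x].

Definition elim_degree H (a : {ffun V -> 'I_#|V|}) (v : V) : nat :=
  #|[set w | H v w & a v < a w]|.

(* The value of F at some PEO of H. It is only meant for chordal H, which have a
   PEO, and for F that depends only on the multiset of elimination degrees,
   which is the same for all PEOs of H; the value 0 when there is no PEO is
   a dummy. *)
Definition at_peo H (F : {ffun V -> 'I_#|V|} -> nat) : nat :=
  if [pick a | is_peo H a] is Some a then F a else 0.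

Definition nnz H : nat :=
  at_peo H (fun a => \sum_(v : V) (elim_degree H a v).+1).

Definition flop H : nat :=
  at_peo H (fun a => \sum_(v : V) (elim_degree H a v).+1 ^ 2).

Definition omega H : nat :=
  at_peo H (fun a => \max_(v : V) (elim_degree H a v).+1).

Definition minimizes (f : sgraph V -> nat) G H : Prop :=
  triangulation G H /\ forall H', triangulation G H' -> f H <= f H'.

End Triangulations.

(* Main.v *)
Require Import Defs.
From mathcomp Require Import all_boot zify.

Set Implicit Arguments.
Unset Strict Implicit.
Unset Printing Implicit Defensive.

(** The three costs are read off from any perfect elimination ordering: the
    elimination degrees d satisfy that the sum of 2 d is the number of ordered
    pairs of adjacent vertices, that the sum of 3 d (d - 1) is the number of
    ordered triples of mutually adjacent vertices, and that the maximum of d + 1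
    is the clique number.  So nnz, flop and omega do not depend on the ordering,
    and adding edges to a chordal graph never decreases them ([nnz_le],
    [flop_le], [omega_le]).

    If both sides of a join contain a pair of non-adjacent vertices, the two
    pairs form an induced cycle of length four.  Hence a triangulation H of G
    turns the cycle into a clique, and then H contains T1, or it turns S_t + K_c
    into a clique ([triangulation_cases]).  In the second case a perfect
    elimination ordering of H, restricted to the cycle, clips the cycle ear by
    ear: the vertex of a cycle that comes first in the ordering has its two neighbours on the cycle joined
    by an edge, which closes a shorter cycle.  The edges met in this way form
    a triangulated polygon E inside H, whose elimination degrees are
    2, ..., 2, 1, 0 ([ear_clipping]).  So H contains the join of E with K_(t+c),
    whose costs do not depend on E.

    Every triangulation therefore costs at least as much as T1 in all three
    measures, or at least as much as a polygon joined with K_(t+c) in all three.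
    A minimal triangulation of the cycle is equal to the polygon that it
    contains, so T2 is of the second kind.  It remains to compare two numbers for
    each measure; flop needs n > 64 since the difference of the two values of
    flop is 5 n^3 - 320.5 n^2 - 12.5 n + 13.

    Comparing costs over all triangulations requires that each of them has
    a perfect elimination ordering.  This is the theorem of Dirac
    ([chordal_peo]): a chordal graph has a simplicial vertex, and one may ask for
    it outside the closed neighbourhood of any given non-universal vertex, which
    makes the induction work ([simplicial_nonneighbour]). *)

(** * Elimination orderings and the three costs *)

Section Ranks.
Variable V : finType.
Implicit Types (H : sgraph V) (r : V -> nat) (u v w x y z : V).

Definition updeg H r v := #|[set w | H v w & r v < r w]|.

Definition elim_rel H r := forall v w x,
  H v w -> r v < r w -> H v x -> r v < r x -> w != x -> H w x.

(** A perfect elimination ordering with arbitrary natural numbers as positions,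
    of which only the order matters.  Positions can then be given by formulas and
    restricted to a set of vertices without renumbering. *)
Definition peo_rank H r := injective r /\ elim_rel H r.

Lemma is_peoP H (a : {ffun V -> 'I_#|V|}) :
  is_peo H a <-> peo_rank H (fun v => a v).
Proof.
split=> [/andP [/injectiveP inja peo] | [inja peo]].
  split=> [v w /val_inj/inja //|v w x Hvw vw Hvx vx wx].
  move/forallP/(_ v)/forallP/(_ w)/forallP/(_ x): peo.
  by rewrite Hvw vw Hvx vx wx.
apply/andP; split; first by apply/injectiveP => v w avw; apply: inja; rewrite avw.
apply/'forall_forallP => v w; apply/forallP => x; apply/implyP.
by case/and5P => Hvw vw Hvx vx wx; apply: peo Hvw vw Hvx vx wx.
Qed.

Definition above r v := #|[set w | r v < r w]|.

Lemma ltn_above r v : above r v < #|V|.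
Proof.
rewrite -cardsT; apply/proper_card/properP; split; first exact: subsetT.
by exists v; rewrite ?inE ?ltnn.
Qed.

Lemma above_anti r v w : r v < r w -> above r w < above r v.
Proof.
move=> vw; apply/proper_card/properP; split.
  by apply/subsetP => x; rewrite !inE; apply: ltn_trans.
by exists w; rewrite !inE ?ltnn.
Qed.

Lemma above_inj r : injective r -> injective (above r).
Proof.
move=> injr v w eq_vw; apply: injr.
by case: (ltngtP (r v) (r w)) => // /above_anti; rewrite eq_vw ltnn.
Qed.

Lemma above_mono r v w : injective r -> (above r w < above r v) = (r v < r w).
Proof.
move=> injr; case: (ltngtP (r v) (r w)) => [/above_anti //|/above_anti|/injr ->].
  by case: ltngtP.
by rewrite ltnn.
Qed.

(** The number of later vertices takes each of the values 0, ..., #|V| - 1 once. *)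
Lemma sum_above r (F : nat -> nat) : injective r ->
  \sum_v F (above r v) = \sum_(i < #|V|) F i.
Proof.
move=> injr; pose f v : 'I_#|V| := Ordinal (ltn_above r v).
have injf : injective f by move=> v w [] /(above_inj injr).
have bijf : bijective f by apply: inj_card_bij; rewrite ?card_ord.
by rewrite (reindex f) //; apply: onW_bij.
Qed.

(** The position of v becomes #|V| - 1 minus the number of later vertices. *)
Lemma peo_rank_peo H r : peo_rank H r -> exists a, is_peo H a.
Proof.
case=> injr peo.
exists [ffun v => rev_ord (Ordinal (ltn_above r v))]; apply/is_peoP.
have mono v w : (rev_ord (Ordinal (ltn_above r v)) <
                 rev_ord (Ordinal (ltn_above r w))) = (r v < r w).
  rewrite /= -(above_mono v w injr) ltn_sub2lE ?ltnS //; exact: ltn_above.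
split=> [v w|v w x]; rewrite !ffunE.
  move=> e; apply/eqP; apply: contraT => /eqP nvw.
  have := mono v w; have := mono w v; rewrite e ltnn.
  by case: (ltngtP (r v) (r w)) => // /injr.
by rewrite !mono; apply: peo.
Qed.

Lemma at_peoE H r F m : peo_rank H r ->
  (forall a, is_peo H a -> F a = m) -> at_peo H F = m.
Proof.
move=> /peo_rank_peo [a0 peo0] Fm; rewrite /at_peo.
by case: pickP => [a /Fm //|/(_ a0)]; rewrite peo0.
Qed.

Definition pairs H := \sum_x \sum_y H x y.
Definition triples H := \sum_x \sum_y \sum_z [&& H x y, H x z & H y z].

Lemma updegE H r v : updeg H r v = \sum_w (H v w && (r v < r w)).
Proof.
rewrite /updeg -sum1_card big_mkcond /=.
by apply: eq_bigr => w _; rewrite inE; case: (_ && _).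
Qed.

(** Each edge is counted once, at its earlier end, by the elimination degrees. *)
Lemma pairsE H r : injective r -> pairs H = 2 * \sum_v updeg H r v.
Proof.
move=> injr; rewrite mul2n -addnn.
rewrite {2}(eq_bigr _ (fun v _ => updegE H r v)) (eq_bigr _ (fun v _ => updegE H r v)).
rewrite [X in _ = _ + X]exchange_big /= -big_split.
apply: eq_bigr => x _; rewrite -big_split; apply: eq_bigr => y _ /=.
rewrite (adj_sym H y x).
case: (ltngtP (r x) (r y)) => [||/injr ->]; rewrite ?andbT ?andbF ?addn0 //.
by rewrite adj_irr.
Qed.

(** The later neighbours of v are mutually adjacent, so any two of them form with
    v a triangle whose earliest vertex is v.  Each triangle arises once in this
    way.  The factor 3 is the choice of the coordinate of a triple that holds the
    earliest vertex; the order of the other two is counted by d (d - 1). *)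
Lemma triplesE H r : peo_rank H r ->
  triples H = 3 * \sum_v updeg H r v * (updeg H r v).-1.
Proof.
move=> [injr peo].
pose up v w := H v w && (r v < r w).
pose P x y z := [&& up x y, up x z & y != z].
have sumP x : \sum_y \sum_z P x y z = updeg H r x * (updeg H r x).-1.
  rewrite {1}/updeg -sum1_card big_distrl /= [RHS]big_mkcond /=.
  apply: eq_bigr => y _; rewrite inE -/(up x y) /P.
  case: ifP => uxy /=; last by rewrite big1.
  rewrite mul1n /updeg (cardsD1 y) inE -/(up x y) uxy /=.
  rewrite -sum1_card [RHS]big_mkcond /=; apply: eq_bigr => z _.
  by rewrite !inE -/(up x z) eq_sym andbC; case: (_ && _).
transitivity (\sum_x \sum_y \sum_z (P x y z + P y x z + P z x y)).
  apply: eq_bigr => x _; apply: eq_bigr => y _; apply: eq_bigr => z _.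
  have [Hxy /=|] := boolP (H x y); last first.
    move=> nH; rewrite /P /up (adj_sym H y x) (negbTE nH) /= addn0.
    case: eqVneq => [->|xy]; rewrite ?andbF //.
    by rewrite andbT; case: andP => // -[/andP [Hz zx] /andP [Hz' zy]]; rewrite (peo z x y) in nH.
  have [Hxz /=|nH] := boolP (H x z); last first.
    rewrite /P /up (adj_sym H z x) (negbTE nH) /= andbF addn0 /=.
    case: (eqVneq x z) => [|xz]; rewrite ?andbF // !andbT.
    by case: andP => // -[/andP [Hz zx] /andP [Hz' zy]]; rewrite (peo y x z) in nH.
  have [Hyz /=|nH] := boolP (H y z); last first.
    rewrite /P /up (adj_sym H z y) (negbTE nH) /= !andbF !addn0.
    case: (eqVneq y z) => [|yz]; rewrite ?andbF // !andbT.
    by case: andP => // -[/andP [Hz zx] /andP [Hz' zy]]; rewrite (peo x y z) in nH.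
  have neq u v : H u v -> r u <> r v.
    by move=> Huv /injr e; move: Huv; rewrite e adj_irr.
  have neqb u v : H u v -> u != v.
    by move=> Huv; apply/eqP => e; move: Huv; rewrite e adj_irr.
  rewrite /P /up (adj_sym H y x) (adj_sym H z x) (adj_sym H z y) Hxy Hxz Hyz /=.
  rewrite !neqb // !andbT.
  have := neq _ _ Hxy; have := neq _ _ Hxz; have := neq _ _ Hyz.
  by case: ltngtP; case: ltngtP; case: ltngtP; lia.
transitivity (\sum_x \sum_y \sum_z P x y z + \sum_x \sum_y \sum_z P y x z
              + \sum_x \sum_y \sum_z P z x y).
  rewrite -!big_split; apply: eq_bigr => x _; rewrite -!big_split.
  by apply: eq_bigr => y _; rewrite -!big_split.
rewrite [X in _ + X + _]exchange_big /=.
rewrite [X in _ + X](eq_bigr (fun x => \sum_z \sum_y P z x y)); last first.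
  by move=> x _; rewrite exchange_big.
rewrite [X in _ + X]exchange_big /= -(eq_bigr _ (fun x _ => sumP x)).
lia.
Qed.

Lemma sum_updeg_pairs H r : injective r ->
  2 * \sum_v (updeg H r v).+1 = pairs H + 2 * #|V|.
Proof.
move=> injr; rewrite (pairsE H injr) -mulnDr.
under eq_bigr do rewrite -addn1.
by rewrite big_split /= sum1_card.
Qed.

Lemma sum_updeg_sqr H r : peo_rank H r ->
  6 * \sum_v (updeg H r v).+1 ^ 2 = 2 * triples H + 9 * pairs H + 6 * #|V|.
Proof.
move=> peo; rewrite (triplesE peo) (pairsE H (proj1 peo)) -sum1_card.
rewrite !mulnA !big_distrr /= -!big_split /=.
by apply: eq_bigr => v _; case: (updeg H r v) => [|d] /=; rewrite -?mulnn; nia.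
Qed.

(** The witness is the earliest vertex of the clique. *)
Lemma clique_updeg H r (K : {set V}) : injective r -> K != set0 ->
  {in K &, forall x y, x != y -> H x y} -> exists2 v, v \in K & #|K| <= (updeg H r v).+1.
Proof.
move=> injr /set0Pn [x0 x0K] clK.
case: (arg_minnP r x0K) => v vK0 vmin; have vK : v \in K := vK0; exists v => //.
rewrite (cardsD1 v) vK ltnS; apply/subset_leq_card/subsetP => w.
rewrite !inE => /andP [wv wK]; rewrite clK 1?eq_sym //=.
by rewrite ltn_neqAle (vmin w wK) // andbT; apply: contra wv => /eqP/injr ->.
Qed.

(** A vertex with its later neighbours in H1 is a clique of H1, hence of H2.
    For H1 = H2 this shows that omega does not depend on the ordering. *)
Lemma max_updeg_le (H1 H2 : sgraph V) r1 r2 : subrel H1 H2 ->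
  peo_rank H1 r1 -> injective r2 ->
  \max_v (updeg H1 r1 v).+1 <= \max_v (updeg H2 r2 v).+1.
Proof.
move=> sub [_ peo] inj2; apply/bigmax_leqP => v _.
pose N := [set w | H1 v w & r1 v < r1 w].
have vN : v \notin N by rewrite inE ltnn andbF.
have [|x y|w _] := @clique_updeg H2 r2 (v |: N) inj2.
- by apply/set0Pn; exists v; rewrite setU11.
- rewrite !inE => /predU1P [->|/andP [vx rx]] /predU1P [->|/andP [vy ry]] xy.
  + by rewrite eqxx in xy.
  + exact: sub.
  + by rewrite adj_sym; apply: sub.
  + by apply: sub; apply: (peo v).
rewrite cardsU1 vN => le; apply: leq_trans (leq_bigmax w); exact: le.
Qed.

Section CostFormulas.
Variables (H : sgraph V) (r : V -> nat).
Hypothesis peo : peo_rank H r.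

Lemma nnzE : nnz H = \sum_v (updeg H r v).+1.
Proof.
apply: (at_peoE peo) => a /is_peoP [inja _].
by apply/eqP; rewrite -(eqn_pmul2l (isT : 0 < 2)) (sum_updeg_pairs H inja)
  (sum_updeg_pairs H (proj1 peo)).
Qed.

Lemma flopE : flop H = \sum_v (updeg H r v).+1 ^ 2.
Proof.
apply: (at_peoE peo) => a /is_peoP peoa.
by apply/eqP; rewrite -(eqn_pmul2l (isT : 0 < 6)) (sum_updeg_sqr peoa)
  (sum_updeg_sqr peo).
Qed.

Lemma omegaE : omega H = \max_v (updeg H r v).+1.
Proof.
apply: (at_peoE peo) => a /is_peoP peoa; apply/eqP; rewrite eqn_leq.
have subH : subrel H H by [].
by apply/andP; split; apply: max_updeg_le => //; [case: peo|case: peoa].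
Qed.

End CostFormulas.

Section Monotone.
Variables (H1 H2 : sgraph V) (r1 r2 : V -> nat).
Hypotheses (peo1 : peo_rank H1 r1) (peo2 : peo_rank H2 r2) (sub : subrel H1 H2).

Lemma pairs_le : pairs H1 <= pairs H2.
Proof.
apply: leq_sum => x _; apply: leq_sum => y _.
by case: (boolP (H1 x y)) => // /sub ->.
Qed.

Lemma triples_le : triples H1 <= triples H2.
Proof.
apply: leq_sum => x _; apply: leq_sum => y _; apply: leq_sum => z _.
by case: and3P => // -[/sub -> /sub -> /sub ->].
Qed.

Lemma nnz_le : nnz H1 <= nnz H2.
Proof.
rewrite (nnzE peo1) (nnzE peo2) -(leq_pmul2l (isT : 0 < 2)).
rewrite !sum_updeg_pairs ?leq_add2r ?pairs_le //; by [case: peo1|case: peo2].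
Qed.

Lemma flop_le : flop H1 <= flop H2.
Proof.
rewrite (flopE peo1) (flopE peo2) -(leq_pmul2l (isT : 0 < 6)).
by rewrite !sum_updeg_sqr // leq_add2r leq_add // leq_mul ?triples_le ?pairs_le.
Qed.

Lemma omega_le : omega H1 <= omega H2.
Proof.
by rewrite (omegaE peo1) (omegaE peo2); apply: max_updeg_le => //; case: peo2.
Qed.

End Monotone.
End Ranks.

(** * Cycles in chordal graphs *)

Section Chordal.
Variable V : finType.
Implicit Types (H : sgraph V) (r : V -> nat) (u v w x y z : V).

(** The two neighbours on the cycle of its earliest vertex v are later than v, so
    they are adjacent; with at least four vertices they are not consecutive. *)
Lemma peo_chordal H r : peo_rank H r -> chordal H.
Proof.
move=> [injr peo] s0 /andP [cyc0 uniq0] size0.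
have [x0 x0s] : exists x0, x0 \in s0.
  by case: s0 size0 {cyc0 uniq0} => // x0 s _; exists x0; rewrite inE eqxx.
case: (arg_minnP r x0s) => v vs vmin.
have [i s rot_s] := rot_to vs.
have nextE := next_rot i uniq0; rewrite rot_s in nextE.
have memE x : (x \in v :: s) = (x \in s0) by rewrite -rot_s mem_rot.
have: size (v :: s) = size s0 by rewrite -rot_s size_rot.
have: uniq (v :: s) by rewrite -rot_s rot_uniq.
have: cycle H (v :: s) by rewrite -rot_s rot_cycle.
case: s rot_s nextE memE size0 => [_ _ _|x]; first by case: (s0) => [|? []].
case=> [_ _ _|y]; first by case: (s0) => [|? [|? []]].
case=> [_ _ _|z s]; first by case: (s0) => [|? [|? [|? []]]].
set q := [:: v, x, y, z & s] => _ nextE memE _ cycq uniqq _.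
have vq : v \in q by rewrite inE eqxx.
have xq : x \in q by rewrite !inE eqxx orbT.
have [Hvx Hwv] := (next_cycle cycq vq, prev_cycle cycq vq).
set w := prev q v in Hwv; have wq : w \in q by rewrite mem_prev.
have next_w : next q w = v by rewrite next_prev.
have next_v : next q v = x by rewrite /= eqxx.
have xv : (x == v) = false.
  by move: uniqq; rewrite /= inE eq_sym => /andP [/norP [/negbTE]].
have yv : (y == v) = false.
  by move: uniqq; rewrite /= !inE eq_sym (eq_sym v y) => /andP [/norP [_ /norP [/negbTE]]].
have zv : (z == v) = false.
  by move: uniqq; rewrite /= !inE (eq_sym v z) => /andP [/norP [_ /norP [_ /norP [/negbTE]]]].
have yx : (y == x) = false.
  by move: uniqq; rewrite /= !inE (eq_sym x y) => /and3P [_ /norP [/negbTE]].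
have next_x : next q x = y by rewrite /= xv eqxx.
have next_y : next q y = z by rewrite /= yv yx eqxx.
have wx : w != x by apply/eqP => e; move: next_w; rewrite e next_x => /eqP; rewrite yv.
have wy : w != y by apply/eqP => e; move: next_w; rewrite e next_y => /eqP; rewrite zv.
rewrite next_v in Hvx; rewrite adj_sym in Hwv.
have lower u : u \in q -> H v u -> r v < r u.
  rewrite memE => /vmin le Hvu; rewrite ltn_neqAle le andbT.
  by apply/eqP => /injr e; rewrite e adj_irr in Hvu.
exists w, x; rewrite -!memE -!nextE next_w next_x; split=> //.
- by apply: (peo v) => //; apply: lower.
- by rewrite xv.
Qed.


Lemma next_mid (T : eqType) (s1 s2 : seq T) a b :
  uniq (s1 ++ a :: b :: s2) -> next (s1 ++ a :: b :: s2) a = b.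
Proof.
move=> uq; have nas1 : a \notin s1.
  by move: uq; rewrite cat_uniq => /and3P [_ /hasPn/(_ a)]; rewrite inE eqxx => /(_ isT).
rewrite next_nth mem_cat inE eqxx orbT index_cat (negbTE nas1) /= eqxx addn0.
case: s1 {uq nas1} => [|c s1] //=.
by rewrite nth_cat ltnNge leqnSn /= subSnn.
Qed.

Lemma next_end (T : eqType) (x x0 : T) s : s != [::] ->
  uniq (x :: s) -> next (x :: s) (last x0 s) = x.
Proof.
case: s => // y s _ uq; rewrite -[last x0 _]/(last x (y :: s)).
by rewrite next_nth mem_last index_last // nth_default.
Qed.

Lemma split2 (T : eqType) (s : seq T) a b : a \in s -> b \in s -> a != b ->
  exists s1 s2 s3, s = s1 ++ a :: s2 ++ b :: s3 \/ s = s1 ++ b :: s2 ++ a :: s3.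
Proof.
move=> a_s; case/splitPr: s / a_s => s1 s2.
rewrite mem_cat inE => /or3P [|/eqP ->|].
- move=> b_s; case/splitPr: s1 / b_s => s1 s3 _.
  by exists s1, s3, s2; right; rewrite -catA.
- by rewrite eqxx.
- move=> b_s; case/splitPr: s2 / b_s => s2 s3 _.
  by exists s1, s2, s3; left.
Qed.

(** A vertex v adjacent to both ends of a path, which are not adjacent to each
    other, is adjacent to an inner vertex of the path.  The path and v form a cycle
    of length at least four; a chord at v is the required edge, and any other chord
    shortens the path without changing its ends. *)
Lemma chordal_bypass H v q x0 : chordal H ->
  sorted H q -> uniq (v :: q) -> q != [::] ->
  H v (head x0 q) -> H v (last x0 q) ->
  ~~ H (head x0 q) (last x0 q) -> head x0 q != last x0 q ->
  exists c, [/\ c \in q, H v c, c != head x0 q & c != last x0 q].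
Proof.
move=> chH; have [n] := ubnP (size q); elim: n q => // n IHn q.
rewrite ltnS => le_n sorted_q uniq_q nil_q Hvh Hvl nadj neq.
pose s := v :: q.
have cyc_s : ucycle H s.
  rewrite /ucycle uniq_q andbT /s.
  case: (q) sorted_q nil_q Hvh Hvl => //= x q' sorted_q _ Hvh Hvl.
  by rewrite rcons_path Hvh sorted_q /= adj_sym.
have size_s : 4 <= size s.
  rewrite /s; case: (q) nil_q nadj neq sorted_q => [|x [|y [|z q']]] //=.
    by rewrite eqxx.
  by rewrite andbT => _ /negbTE ->.
have [a [b [a_s b_s Hab bna anb]]] := chH s cyc_s size_s.
have next_v : next s v = head x0 q.
  by rewrite /s; case: (q) nil_q => //= x q' _; rewrite eqxx.
have next_last : next s (last x0 q) = v by apply: next_end.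
have from_v c : H v c -> c \in s -> c != next s v -> v != next s c ->
    exists c, [/\ c \in q, H v c, c != head x0 q & c != last x0 q].
  move=> Hvc; rewrite inE => /predU1P [e|cq]; first by rewrite e adj_irr in Hvc.
  rewrite next_v => ch vc; exists c; split=> //.
  by apply: contra vc => /eqP ->; rewrite next_last.
have [e|av] := eqVneq a v; first by move: Hab bna anb; rewrite e => /from_v; apply.
have [e|bv] := eqVneq b v.
  by move: Hab bna anb; rewrite adj_sym e => /from_v H1 ?? ; apply: H1.
have {}a_s : a \in q by move: a_s; rewrite inE (negbTE av).
have {}b_s : b \in q by move: b_s; rewrite inE (negbTE bv).
have shortcut c d q1 q2 q3 : q = q1 ++ c :: q2 ++ d :: q3 -> H c d -> q2 != [::] ->
    exists c, [/\ c \in q, H v c, c != head x0 q & c != last x0 q].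
  move=> def_q Hcd nil_q2; pose q' := q1 ++ c :: d :: q3.
  have headE : head x0 q' = head x0 q by rewrite def_q /q'; case: (q1).
  have lastE : last x0 q' = last x0 q by rewrite def_q /q' !last_cat /= last_cat.
  have sub_q' : subseq q' q.
    by rewrite def_q cat_subseq //= eqxx; apply: suffix_subseq.
  case: (IHn q'); rewrite ?headE ?lastE //.
  - apply: leq_trans le_n; rewrite def_q /q' !size_cat /= size_cat /=.
    by case: (q2) nil_q2 => // z q2' _; rewrite ltn_add2l /= !addnS !ltnS leq_addl.
  - have: sorted H (q1 ++ [:: c]) && path H d q3.
      move: sorted_q; rewrite def_q; case: (q1) => [|z q1'] /=.
        by rewrite cat_path /= => /and3P [].
      by rewrite !cat_path /= cat_path /= => /and5P [-> -> _ _ ->].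
    rewrite /q'; case: (q1) => [|z q1'] /=; first by rewrite Hcd.
    by rewrite !cat_path /= Hcd andbT => /andP [/andP [-> ->] ->].
  - by move: uniq_q; rewrite /= => /andP [nvq /(subseq_uniq sub_q') ->];
       rewrite andbT; apply: contra nvq; apply: mem_subseq.
  - by rewrite /q'; case: (q1).
  - by move=> e [e_q' *]; exists e; split=> //; apply: mem_subseq e_q'.
have nab : a != b by apply/eqP => e; rewrite e adj_irr in Hab.
have [q1 [q2 [q3 [def_q|def_q]]]] := split2 a_s b_s nab.
  apply: (shortcut a b q1 q2 q3) => //; apply: contra bna => /eqP e.
  move: uniq_q; rewrite /s def_q e => uq.
  by apply/eqP; rewrite (@next_mid _ (v :: q1) q3).
apply: (shortcut b a q1 q2 q3) => //; first by rewrite adj_sym.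
apply: contra anb => /eqP e; move: uniq_q; rewrite /s def_q e => uq.
by apply/eqP; rewrite (@next_mid _ (v :: q1) q3).
Qed.
End Chordal.

(** * Existence of perfect elimination orderings *)

Section Dirac.
Variable V : finType.
Implicit Types (H : sgraph V) (r : V -> nat) (u v w x y z : V) (U : {set V}).

Definition clique_in H (K : {set V}) :=
  [forall x in K, forall y in K, (x != y) ==> H x y].

Definition simplicial H U u := clique_in H [set w in U | H u w].

Lemma clique_inP H (K : {set V}) :
  reflect {in K &, forall x y, x != y -> H x y} (clique_in H K).
Proof.
apply: (iffP 'forall_in_'forall_in_implyP) => [h x y xK yK|h x xK y yK]; exact: h.
Qed.

Lemma clique_inPn H (K : {set V}) :
  reflect (exists x y, [/\ x \in K, y \in K, x != y & ~~ H x y]) (~~ clique_in H K).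
Proof.
rewrite negb_forall_in.
apply: (iffP 'exists_in_idP) => [[x xK]|[x [y [xK yK xy nH]]]].
  rewrite negb_forall_in => /exists_inP [y yK]; rewrite negb_imply => /andP [xy nH].
  by exists x, y.
exists x => //; rewrite negb_forall_in; apply/exists_inP; exists y => //.
by rewrite negb_imply xy.
Qed.

(** C is the component of x in the subgraph induced by U minus the closed
    neighbourhood of v, and S is the set of neighbours of v in U that are
    adjacent to C.
    For two non-adjacent vertices of S, a path between them through C would
    contradict [chordal_bypass], so S is a clique.  Neighbours in U of a vertex of C
    are in C or S, so a vertex of C that is simplicial in the union of C and S is
    simplicial in U.  The induction hypothesis for that union gives such a vertex
    if it is applied to a non-universal vertex taken in S whenever possible. *)
Lemma simplicial_nonneighbour H U v x : chordal H ->
  v \in U -> x \in U -> x != v -> ~~ H v x ->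
  exists u, [/\ u \in U, u != v, ~~ H v u & simplicial H U u].
Proof.
move=> chH; have [n] := ubnP #|U|; elim: n U v x => // n IHn U v x.
rewrite ltnS => le_n vU xU xv nHvx.
pose W := [set b in U | (b != v) && ~~ H v b].
pose R := [rel a b | [&& H a b, a \in W & b \in W]].
pose C := [set a | connect R x a].
pose S := [set a in U | H v a & [exists c in C, H c a]].
have xC : x \in C by rewrite inE connect0.
have xW : x \in W by rewrite inE xU xv.
have C_W c : c \in C -> c \in W.
  rewrite inE => /connectP [p]; elim/last_ind: p => [_ -> //|p b _].
  by rewrite rcons_path last_rcons => /andP [_ /= /and3P [_ _ ?]] ->.
have C_out c : c \in C -> [/\ c \in U, c != v & ~~ H v c].
  by move/C_W; rewrite inE => /and3P.
have C_step c b : c \in C -> H c b -> b \in U -> b != v -> b \in C :|: S.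
  move=> cC Hcb bU bv; rewrite !inE bU /=.
  case: (boolP (H v b)) => Hvb /=.
    by apply/orP; right; apply/exists_inP; exists c.
  have cW := C_W c cC; rewrite orbF; rewrite inE in cC; apply: connect_trans cC (connect1 _).
  by rewrite /= Hcb cW inE bU bv.
have clS : clique_in H S.
  apply: contraT => /clique_inPn [a [b []]]; rewrite !inE.
  case/and3P => aU Hva /exists_inP [c cC Hca] /and3P [bU Hvb /exists_inP [d dC Hdb]] ab nab.
  have sR : connect_sym R.
    by apply: sym_connect_sym => e f /=; rewrite adj_sym [(e \in W) && _]andbC.
  have : connect R c d.
    by move: cC dC; rewrite !inE sR => ?; apply: connect_trans.
  case/connectP => p0 /shortenP [p path_p uniq_p _] last_p.
  have pW : {subset c :: p <= W}.
    move=> e; rewrite inE => /predU1P [->|]; first exact: C_W.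
    move: path_p; elim: (p) (c) => //= f p' IH g /andP [/and3P [_ _ fW] /IH {}IH].
    by rewrite inE => /predU1P [->|/IH].
  have notW e : H v e -> e \notin W by move=> Hve; rewrite inE Hve !andbF.
  have vW : v \notin W by rewrite inE eqxx andbF.
  pose q := a :: rcons (c :: p) b.
  have headE : head v q = a by [].
  have lastE : last v q = b by rewrite /q /= last_rcons.
  have neq e : H v e -> (v == e) = false.
    by move=> Hve; apply/eqP => e'; rewrite -e' adj_irr in Hve.
  have sorted_q : sorted H q.
    rewrite /q /= rcons_path adj_sym Hca -last_p Hdb andbT /=.
    by apply: sub_path path_p => e f /= /andP [].
  have nq e : e \notin W -> e \notin c :: p by apply: contra => /pW.
  have uniq_q : uniq (v :: q).
    rewrite cons_uniq; apply/andP; split.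
      by rewrite in_cons mem_rcons in_cons !neq // !orFb nq.
    rewrite cons_uniq; apply/andP; split.
      by rewrite mem_rcons in_cons (negbTE ab) orFb nq ?notW.
    by rewrite rcons_uniq uniq_p nq ?notW.
  have := chordal_bypass (x0 := v) chH sorted_q uniq_q isT.
  rewrite headE lastE => /(_ Hva Hvb nab ab) [e [eq Hve ea eb]].
  move: eq; rewrite /q inE mem_rcons inE => /or3P [/eqP e'|/eqP e'|/pW eW].
  - by rewrite e' eqxx in ea.
  - by rewrite e' eqxx in eb.
  - by rewrite (negbTE (notW e Hve)) in eW.
have v_notin : v \notin C :|: S.
  rewrite !inE adj_irr andbF orbF; apply/negP => vC.
  by have [] := C_out v; rewrite ?inE // eqxx.
have CS_sub : C :|: S \subset U.
  apply/subUsetP; split; apply/subsetP => b; first by case/C_out.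
  by rewrite inE => /and3P [].
have simpC u : u \in C -> simplicial H (C :|: S) u ->
    exists u, [/\ u \in U, u != v, ~~ H v u & simplicial H U u].
  move=> uC /clique_inP simp; have [uU uv nHvu] := C_out u uC; exists u; split=> //.
  have nbr b : b \in [set w in U | H u w] -> b \in [set w in C :|: S | H u w].
    rewrite inE => /andP [bU Hub]; rewrite inE (C_step u) //.
    by apply: contra nHvu => /eqP <-; rewrite adj_sym.
  by apply/clique_inP => a b /nbr aN /nbr bN; apply: simp.
have [/clique_inP clCS|] := boolP (clique_in H (C :|: S)).
  apply: (simpC x) => //; apply/clique_inP => a b; rewrite inE => /andP [aC _].
  by rewrite inE => /andP [bC _]; apply: clCS.
have ltCS : #|C :|: S| < n.
  apply: leq_trans le_n; apply/proper_card/properP; split=> //; by exists v.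
have step w b : w \in C :|: S -> b \in C :|: S -> b != w -> ~~ H w b ->
    (forall u, u \in S -> u != w -> ~~ H w u -> False) ->
    exists u, [/\ u \in U, u != v, ~~ H v u & simplicial H U u].
  move=> wCS bCS bw nHwb outS.
  have [u [uCS uw nHwu simpu]] := IHn _ w b ltCS wCS bCS bw nHwb.
  apply: (simpC u) => //; move: uCS; rewrite in_setU => /orP [//|uS].
  by case: (outS u uS uw nHwu).
case/clique_inPn => a [b [aCS bCS ab nHab]].
(* The simplicial vertex must avoid S.  If w is in S, it does since S is
   a clique; otherwise every vertex of S is universal in C :|: S. *)
have [/exists_inP [w wS /exists_inP [d dCS /andP [dw nHwd]]]|] :=
    boolP [exists w in S, exists d in C :|: S, (d != w) && ~~ H w d].
  apply: (step w d) => //; first by rewrite in_setU wS orbT.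
  by move=> u uS uw; rewrite (clique_inP _ _ clS) // eq_sym.
rewrite negb_exists_in => /forall_inP univS.
apply: (step a b) => //; first by rewrite eq_sym.
move=> u uS ua nHau; have := univS u uS.
rewrite negb_exists_in => /forall_inP/(_ a aCS).
by rewrite eq_sym ua adj_sym nHau.
Qed.

Lemma simplicial_exists H U : chordal H -> U != set0 ->
  exists2 u, u \in U & simplicial H U u.
Proof.
move=> chH /set0Pn [x xU].
have [/clique_inP clU|/clique_inPn [a [b [aU bU ab nHab]]]] := boolP (clique_in H U).
  exists x => //; apply/clique_inP => a b.
  by rewrite inE => /andP [aU _]; rewrite inE => /andP [bU _]; apply: clU.
have [|u [uU _ _ simpu]] := simplicial_nonneighbour chH aU bU _ nHab.
  by rewrite eq_sym.
by exists u.
Qed.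

(** The simplicial vertex is placed first, and the others are shifted by one. *)
Lemma chordal_peo H : chordal H -> exists r, peo_rank H r.
Proof.
move=> chH.
suff [r [injr peo]] : exists r, {in [set: V] &, injective r} /\
    forall v w x, v \in [set: V] -> w \in [set: V] -> x \in [set: V] ->
      H v w -> r v < r w -> H v x -> r v < r x -> w != x -> H w x.
  by exists r; split=> [v w e|v w x]; [apply: injr|apply: peo].
have [n] := ubnP #|[set: V]|; elim: n [set: V] => // n IHn U leU.
have [->|U0] := eqVneq U set0.
  by exists (fun=> 0); split=> [v w|v w x]; rewrite inE.
have [u uU /clique_inP simpu] := simplicial_exists chH U0.
have [|r [injr peo]] := IHn (U :\ u).
  by move: leU; rewrite (cardsD1 u U) uU.
exists (fun w => if w == u then 0 else (r w).+1); split.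
  move=> v w vU wU; case: (eqVneq v u) => [->|vu]; case: (eqVneq w u) => [->|wu] //.
  by case=> /injr ->; rewrite ?inE ?vu ?wu.
move=> v w x vU wU xU Hvw; case: (eqVneq w u) => // wu; case: (eqVneq x u) => // xu.
case: (eqVneq v u) => [e _ Hvx _ wx|vu].
  by apply: simpu => //; rewrite inE -e ?Hvw ?Hvx ?wU ?xU.
by rewrite !ltnS => vw Hvx vx wx; apply: (peo v); rewrite ?inE ?vu ?wu ?xu.
Qed.
End Dirac.

(** * Triangulated polygons *)

Section Ears.
Variable V : finType.

Section AddEar.
Variables (E : sgraph V) (v x y : V).
Hypotheses (vx : v != x) (vy : v != y).

Definition ear_rel : rel V := fun a b =>
  [|| E a b, (a == v) && (b \in [:: x; y]) | (b == v) && (a \in [:: x; y])].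

Lemma ear_sym : symmetric ear_rel.
Proof. by move=> a b; rewrite /ear_rel adj_sym [(_ && _) || _]orbC. Qed.

Lemma ear_irr : irreflexive ear_rel.
Proof.
move=> a; rewrite /ear_rel adj_irr orbb /= !inE.
by apply/andP => -[/eqP ->]; rewrite (negbTE vx) (negbTE vy).
Qed.

Definition add_ear := SGraph ear_sym ear_irr.
End AddEar.

(** A single vertex counts as a closed walk, so that clipping a vertex off a cycle
    of length two is not a special case. *)
Definition wcycle (e : rel V) s := (size s <= 1) || cycle e s.

Variables (H : sgraph V) (r : V -> nat).
Hypothesis peo : peo_rank H r.

(** Let v be the earliest vertex of s, with neighbours x and y on s.  They are
    later than v, so they are adjacent or equal and s without v is again a cycle of
    H.  Adding v with the edges v x and v y to the graph built for that shorter cycle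
    changes no elimination degree of the other vertices, which are later than v. *)
Lemma ear_clipping (s : seq V) : uniq s -> wcycle H s ->
  exists E : sgraph V,
  [/\ subrel E H, forall a b, E a b -> a \in s, wcycle E s, elim_rel E r &
      forall u, u \in s -> updeg E r u = minn 2 (count (fun w => r u < r w) s)].
Proof.
case: peo => injr peoH.
have [n] := ubnP (size s); elim: n s => // n IHn s0; rewrite ltnS => le_n uniq0.
rewrite {1}/wcycle; case: leqP => [le1 _|size0 /= cyc0].
  exists (edgeless V); split => //; first by rewrite /wcycle le1.
  move=> u; case: s0 le1 {le_n uniq0} => [|z [|]] //= _; rewrite inE => /eqP ->.
  by rewrite ltnn /updeg eq_card0 // => w; rewrite inE.
have [x0 x0s] : exists x0, x0 \in s0.
  by case: s0 size0 {cyc0 uniq0 le_n} => // x s _; exists x; rewrite inE eqxx.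
case: (arg_minnP r x0s) => v vs vmin.
have [i s rot_s] := rot_to vs.
have memE x : (x \in s0) = (x \in v :: s) by rewrite -rot_s mem_rot.
have cycE (e : rel V) : cycle e s0 = cycle e (v :: s) by rewrite -rot_s rot_cycle.
have countE p : count p s0 = count p (v :: s).
  by rewrite -rot_s; apply/permP; rewrite perm_sym perm_rot.
rewrite -(size_rot i s0) rot_s in le_n size0.
rewrite -(rot_uniq i s0) rot_s in uniq0.
rewrite cycE in cyc0.
have lower u : u \in s -> r v < r u.
  move=> us; have us0 : u \in s0 by rewrite memE inE us orbT.
  have le : r v <= r u by apply: vmin.
  rewrite ltn_neqAle le andbT; apply/eqP => /injr e.
  by move: uniq0; rewrite /= e us.
have cnt_v : count (fun w => r v < r w) s0 = size s.
  by rewrite countE /= ltnn add0n; apply/eqP; rewrite -all_count; apply/allP.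
have cnt_s u : u \in s -> count (fun w => r u < r w) s0 = count (fun w => r u < r w) s.
  by move=> us; rewrite countE /= ltnNge ltnW ?lower.
case: s => [//|x q] in rot_s memE cycE countE le_n size0 uniq0 cyc0 lower cnt_v cnt_s *.
pose y := last x q.
have xs : x \in x :: q by rewrite inE eqxx.
have ys : y \in x :: q by rewrite mem_last.
have xy_sub a : a \in [:: x; y] -> a \in x :: q.
  by rewrite in_cons mem_seq1 => /orP [] /eqP ->.
have vns : v \notin x :: q by case/andP: uniq0.
have vx : v != x by apply: contra vns => /eqP ->.
have vy : v != y by apply: contra vns => /eqP ->.
move: cyc0; rewrite [cycle _ _]/= rcons_path -/y => /and3P [Hvx path_q Hyv].
have xyq : (x == y) = (size q == 0).
  rewrite /y; case: (q) uniq0 => [|z q']; first by rewrite eqxx.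
  case/and3P => _ nx _ /=; apply: contraNF nx => /eqP ->; exact: mem_last.
have wcyc (e : rel V) : wcycle e (x :: q) = (size q == 0) || path e x q && e y x.
  by rewrite /wcycle /= rcons_path ltnS leqn0.
have [|||E' [subE' suppE' + peoE' degE']] := IHn (x :: q).
- exact: le_n.
- by case/andP: uniq0.
- rewrite wcyc path_q -xyq /=; case: eqVneq => //= xy.
  by apply: (peoH v) => //; rewrite 1?adj_sym ?lower 1?eq_sym.
rewrite wcyc => cycE'.
have E'v a : E' v a = false by apply/negP => /suppE'; apply/negP.
pose E := add_ear E' vx vy.
have EE a b : E a b =
  [|| E' a b, (a == v) && (b \in [:: x; y]) | (b == v) && (a \in [:: x; y])] by [].
have Ev a : E v a = (a \in [:: x; y]).
  by rewrite EE E'v eqxx !inE (negbTE vx) (negbTE vy) andbF orbF.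
have Es a b : r v < r a -> r a < r b -> E a b = E' a b.
  move=> va ab; rewrite EE.
  case: eqVneq => [e|_] /=; first by rewrite e ltnn in va.
  by case: eqVneq => [e|_] /=; [move: ab; rewrite e ltnNge ltnW | rewrite orbF].
exists E; split.
- move=> a b /or3P [/subE' //| |] /andP [/eqP -> ].
    by rewrite !inE => /orP [] /eqP -> //; rewrite adj_sym.
  by rewrite !inE => /orP [] /eqP -> //; rewrite adj_sym.
- move=> a b; rewrite memE in_cons => /or3P [/suppE' ->|/andP [-> //]|/andP [_]].
    by rewrite orbT.
  by move/xy_sub ->; rewrite orbT.
- apply/orP; right; rewrite cycE.
  have -> : cycle E [:: v, x & q] = E v x && path E x (rcons q v) by [].
  rewrite rcons_path -/y Ev (adj_sym E y) Ev.
  rewrite !in_cons !eqxx orbT andbT andTb.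
  move: cycE'; case: eqP => [/size0nil -> //|_ /andP [pathE' _]].
  by apply: sub_path pathE' => a b E'ab; apply/orP; left.
- move=> a b c; case: (eqVneq a v) => [->|av].
    rewrite !Ev EE => bxy _ cxy _ bc; apply/orP; left.
    have E'yx : x != y -> E' y x.
      by rewrite xyq => /negbTE nq; move: cycE'; rewrite nq => /andP [].
    move: bxy cxy bc; rewrite !inE => /orP [] /eqP -> /orP [] /eqP ->; rewrite ?eqxx //.
      by move=> xy; rewrite adj_sym E'yx.
    by rewrite eq_sym; apply: E'yx.
  have [as_|nas] := boolP (a \in x :: q); last first.
    move=> + ab; rewrite EE (negbTE av) /= => /orP [/suppE'|/andP [/eqP e]].
      by rewrite (negbTE nas).
    by rewrite !inE => /orP [] /eqP e'; rewrite e' ?xs ?ys in nas.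
  have va := lower _ as_.
  move=> + ab + ac; rewrite (Es a b) // (Es a c) // => E'ab E'ac bc.
  by rewrite EE (peoE' a).
- move=> u; rewrite memE inE => /predU1P [->|us].
    rewrite cnt_v /updeg (eq_card (B := [set x; y])); last first.
      move=> a; rewrite !inE Ev !inE.
      by apply: andb_idr => /orP [] /eqP ->; apply: lower.
    by rewrite cards2 xyq /=; case: (size q) => [|[|]].
  rewrite cnt_s // -degE' // /updeg; apply: eq_card => a; rewrite !inE.
  case: (ltnP (r u) (r a)) => [ua|]; rewrite ?andbF // !andbT Es //; exact: lower.
Qed.
End Ears.

Section Hamiltonian.
Variables (V : finType) (H : sgraph V) (r : V -> nat).

Lemma hamiltonian_ears (C : sgraph V) (s : seq V) : peo_rank H r -> uniq s ->
    1 < size s -> (forall x, x \in s) -> (forall x y, C x y -> (y == next s x) || (x == next s y)) ->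
    cycle H s -> 
  exists E : sgraph V, [/\ subrel E H, subrel C E, peo_rank E r &
      forall v, updeg E r v = minn 2 (above r v)].
Proof.
move=> peo uniq_s size_s all_s Cnext cyc_s.
have wcyc : wcycle H s by rewrite /wcycle cyc_s orbT.
have [E [subE _ cycE peoE degE]] := ear_clipping peo uniq_s wcyc.
rewrite /wcycle leqNgt size_s /= in cycE.
exists E; split=> //.
- by move=> x y /Cnext /orP [] /eqP ->; [|rewrite adj_sym]; apply: next_cycle.
- by split=> //; case: peo.
move=> v; rewrite degE // /above cardE; congr minn.
rewrite -size_filter; apply: perm_size; apply: uniq_perm.
- exact: filter_uniq.
- exact: enum_uniq.
by move=> x; rewrite mem_filter mem_enum inE all_s andbT.
Qed.
End Hamiltonian.

Section Cycle.
Variable l : nat.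
Hypothesis l3 : 3 <= l.

Lemma next_enum_ord (i : 'I_l) : next (enum 'I_l) i = ordS i.
Proof.
apply: val_inj; rewrite next_nth mem_enum index_enum_ord.
have lt_i := ltn_ord i.
case def_e: (enum 'I_l) => [|x e]; first by move: (mem_enum 'I_l i); rewrite def_e.
rewrite -[nth x e i]/(nth x (x :: e) i.+1) -def_e /=.
have [lt|ge] := ltnP i.+1 l; first by rewrite nth_enum_ord // modn_small.
rewrite nth_default ?size_enum_ord //.
have -> : x = nth x (enum 'I_l) 0 :> nat by rewrite def_e.
have -> : i.+1 = l by apply/eqP; rewrite eqn_leq lt_i.
by rewrite nth_enum_ord ?modnn // (leq_trans _ lt_i).
Qed.

Lemma cycle_graph_ears (H : sgraph 'I_l) r : subrel (cycle_graph l) H -> peo_rank H r ->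
  exists E : sgraph 'I_l, [/\ subrel E H, subrel (cycle_graph l) E, peo_rank E r &
      forall v, updeg E r v = minn 2 (above r v)].
Proof.
move=> subH peo; apply: (hamiltonian_ears (s := enum 'I_l) peo).
- exact: enum_uniq.
- by rewrite size_enum_ord ltnW.
- by move=> x; rewrite mem_enum.
- by move=> x y /= /andP [_]; rewrite !next_enum_ord.
apply: cycle_from_next => [|x _]; first exact: enum_uniq.
apply: subH; rewrite next_enum_ord /= /cycle_rel eqxx andbT.
apply/eqP => /(congr1 val) /=; have := ltn_ord x.
rewrite leq_eqVlt => /predU1P [e|lt]; last by rewrite modn_small; lia.
by rewrite e modnn; lia.
Qed.
End Cycle.

(** * Joins *)

Section Joins.
Variables V1 V2 : finType.

(** Non-adjacent x, y on the left and u, w on the right would make x, u, y, w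
    a chordless cycle of length four. *)
Lemma chordal_join (H : sgraph (V1 + V2)%type) : chordal H ->
  (forall x u, H (inl x) (inr u)) ->
  (forall x y, x != y -> H (inl x) (inl y)) \/ (forall u w, u != w -> H (inr u) (inr w)).
Proof.
move=> chH cross.
have [/forallP cl1|] :=
    boolP [forall x, [forall y, (x != y) ==> H (inl x) (inl y)]].
  by left=> x y; have /forallP/(_ y)/implyP := cl1 x.
rewrite negb_forall => /existsP [x]; rewrite negb_forall => /existsP [y].
rewrite negb_imply => /andP [xy nHxy]; right=> u w uw; apply: contraT => nHuw.
have sorted_q : sorted H [:: inr u; inl y; inr w] by rewrite /= cross adj_sym cross.
have uniq_q : uniq [:: inl x; inr u; inl y; inr w].
  have eL (a b : V1) : (inl a == inl b :> V1 + V2) = (a == b) by [].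
  have eR (a b : V2) : (inr a == inr b :> V1 + V2) = (a == b) by [].
  by rewrite /= !inE !eL !eR (negbTE xy) (negbTE uw).
have := chordal_bypass (x0 := inl x) chH sorted_q uniq_q isT.
case=> [||||c []] //=; rewrite !inE => /or3P [] /eqP -> //; last by rewrite eqxx.
- by rewrite eqxx.
- by rewrite (negbTE nHxy).
Qed.

Definition induced (f : V1 -> V2) (H : sgraph V2) : sgraph V1 :=
  @SGraph V1 (relpre f H) (fun x y => adj_sym H (f x) (f y)) (fun x => adj_irr H (f x)).

Lemma induced_peo (f : V1 -> V2) (H : sgraph V2) r : injective f ->
  peo_rank H r -> peo_rank (induced f H) (r \o f).
Proof.
move=> injf [injr peo]; split; first exact: inj_comp.
by move=> v w x Hvw vw Hvx vx wx; apply: (peo (f v)); rewrite // (inj_eq injf).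
Qed.

End Joins.

Lemma card_sum_type (V1 V2 : finType) (P : pred (V1 + V2)) :
  #|[set w | P w]| = #|[set x | P (inl x)]| + #|[set x | P (inr x)]|.
Proof.
by rewrite -!sum1dep_card big_mkcond big_sumType /= -!big_mkcond.
Qed.

Lemma card_set_true (V : finType) (P : pred V) : P =1 xpredT -> #|[set x | P x]| = #|V|.
Proof. by move=> PT; rewrite -cardsT; apply: eq_card => x; rewrite !inE PT. Qed.

Lemma card_set_false (V : finType) (P : pred V) : P =1 xpred0 -> #|[set x | P x]| = 0.
Proof. by move=> P0; apply: eq_card0 => x; rewrite !inE P0. Qed.

Section JoinComplete.
Variables (V1 V2 : finType) (E : sgraph V1) (r : V1 -> nat).
Hypothesis peoE : peo_rank E r.

Let top := (\max_x r x).+1.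
(** With the clique V2 last, every vertex of V1 gains #|V2| later neighbours. *)
Definition join_rank (w : V1 + V2) : nat :=
  match w with inl x => r x | inr u => top + enum_rank u end.

Lemma ltn_top x : r x < top. Proof. by rewrite ltnS leq_bigmax. Qed.

Lemma join_complete_peo : peo_rank (gjoin E (complete V2)) join_rank.
Proof.
case: peoE => injr peo; split.
  move=> [x|u] [y|w] /= e.
  - by rewrite (injr _ _ e).
  - by have := ltn_top x; rewrite e -ltn_subRL subnn.
  - by have := ltn_top y; rewrite -e -ltn_subRL subnn.
  - by move/addnI/val_inj/enum_rank_inj: e => ->.
move=> [v|v] [w|w] [x|x] //=; first exact: peo.
all: try by move=> _ /ltnW; rewrite leqNgt (leq_trans (ltn_top _)) // leq_addr.
Qed.

Lemma updeg_join_inl x :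
  updeg (gjoin E (complete V2)) join_rank (inl x) = updeg E r x + #|V2|.
Proof.
rewrite /updeg card_sum_type; congr (_ + _).
by apply: card_set_true => u /=; rewrite (leq_trans (ltn_top x)) ?leq_addr.
Qed.

Lemma updeg_join_inr u :
  updeg (gjoin E (complete V2)) join_rank (inr u) = above (enum_rank : V2 -> nat) u.
Proof.
rewrite /updeg card_sum_type card_set_false ?add0n /=; last first.
  by move=> x /=; apply/negbTE; rewrite -leqNgt ltnW // (leq_trans (ltn_top _)) ?leq_addr.
apply: eq_card => w; rewrite !inE ltn_add2l /complete_rel.
by case: eqVneq => [->|]; rewrite ?ltnn.
Qed.

Lemma sum_join_complete (F : nat -> nat) :
  \sum_w F (updeg (gjoin E (complete V2)) join_rank w).+1 =
  \sum_x F (updeg E r x + #|V2|).+1 + \sum_(i < #|V2|) F i.+1.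
Proof.
rewrite big_sumType /=; congr (_ + _).
  by apply: eq_bigr => x _; rewrite updeg_join_inl.
rewrite (eq_bigr _ (fun u _ => congr1 (fun d => F d.+1) (updeg_join_inr u))).
apply: (sum_above (fun d => F d.+1)) => u w /val_inj; exact: enum_rank_inj.
Qed.

End JoinComplete.

Section CompleteJoin.
Variables l t c : nat.

Notation T1 := (gjoin (complete 'I_l) (gsum (edgeless 'I_t) (complete 'I_c))).

(** The independent set comes first, so that the later neighbours of each of its
    vertices are the clique on 'I_l; the remaining vertices form a clique. *)
Definition T1_rank (w : 'I_l + ('I_t + 'I_c)) : nat :=
  match w with inr (inl j) => j | inl i => t + i | inr (inr k) => t + l + k end.

Lemma T1_peo : peo_rank T1 T1_rank.
Proof.
split.
  move=> [x|[x|x]] [y|[y|y]] /= e;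
    have ltx := ltn_ord x; have lty := ltn_ord y; try lia.
  - by congr inl; apply: val_inj => /=; lia.
  - by congr (inr (inl _)); apply: val_inj.
  - by congr (inr (inr _)); apply: val_inj => /=; lia.
move=> [v|[v|v]] [w|[w|w]] [x|[x|x]] //=; have := ltn_ord w; have := ltn_ord x; lia.
Qed.

Lemma above_ord m (i : 'I_m) : above (@nat_of_ord m) i = m - i.+1.
Proof.
have lt_i := ltn_ord i.
rewrite /above -sum1dep_card -(big_mkord (fun j => i < j) (fun=> 1)).
rewrite (big_cat_nat _ (n := i.+1)) //= big_nat_cond big1 ?add0n; last first.
  by move=> j /andP [/andP [_ ltj]]; rewrite ltnNge -ltnS ltj.
rewrite big_nat_cond (eq_bigl (fun j => i.+1 <= j < m)); last first.
  by move=> j /=; case: leqP; rewrite ?andbT ?andbF.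
by rewrite -big_nat sum_nat_const_nat muln1.
Qed.

Lemma updeg_T1_inl i : updeg T1 T1_rank (inl i) = (l - i.+1) + c.
Proof.
rewrite /updeg !card_sum_type /= -above_ord; congr (_ + _).
  apply: eq_card => j; rewrite !inE ltn_add2l /= /complete_rel.
  by case: eqVneq => [->|]; rewrite ?ltnn.
rewrite card_set_false => [|j /=]; last by have := ltn_ord j; lia.
by rewrite add0n card_set_true ?card_ord => // j /=; have := ltn_ord i; lia.
Qed.

Lemma updeg_T1_inr_inl j : updeg T1 T1_rank (inr (inl j)) = l.
Proof.
rewrite /updeg !card_sum_type /= card_set_true => [|i /=]; last first.
  by have := ltn_ord j; lia.
by rewrite !card_set_false ?card_ord ?addn0.
Qed.

Lemma updeg_T1_inr_inr k : updeg T1 T1_rank (inr (inr k)) = c - k.+1.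
Proof.
rewrite /updeg !card_sum_type /= (card_set_false (V := 'I_l)); last first.
  by move=> i /=; have := ltn_ord i; lia.
rewrite (card_set_false (V := 'I_t)) // !add0n -above_ord.
apply: eq_card => j; rewrite !inE ltn_add2l /complete_rel.
by case: eqVneq => [->|]; rewrite ?ltnn.
Qed.

Lemma sum_T1 (F : nat -> nat) :
  \sum_w F (updeg T1 T1_rank w).+1 = t * F l.+1 + \sum_(i < c + l) F i.+1.
Proof.
rewrite !big_sumType /= big_split_ord /= [LHS]addnC -[LHS]addnA.
congr (_ + (_ + _)).
- rewrite (eq_bigr (fun=> F l.+1)) => [|j _]; last by rewrite updeg_T1_inr_inl.
  by rewrite sum_nat_const card_ord.
- rewrite (reindex_inj rev_ord_inj) /=; apply: eq_bigr => k _.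
  by rewrite updeg_T1_inr_inr /=; congr (F _.+1); have := ltn_ord k; lia.
rewrite (reindex_inj rev_ord_inj) /=; apply: eq_bigr => i _.
by rewrite updeg_T1_inl /=; congr (F _.+1); have := ltn_ord i; lia.
Qed.
End CompleteJoin.

(** * Comparison of the triangulations *)

Lemma minimal_triangulation_sub (V : finType) (G H E : sgraph V) :
  minimal_triangulation G H -> triangulation G E -> subrel E H -> subrel H E.
Proof.
move=> [_ minH] triE subE x y Hxy; apply: contraT => /negP nExy; case: minH.
by exists E; split=> // /(_ x y Hxy).
Qed.

Lemma sum_succ m : 2 * \sum_(i < m) i.+1 = m * m.+1.
Proof.
elim: m => [|m IH]; first by rewrite big_ord0.
by rewrite big_ord_recr mulnDr IH /=; lia.
Qed.

Lemma sum_succ_sqr m : 6 * \sum_(i < m) i.+1 ^ 2 = m * m.+1 * (2 * m).+1.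
Proof.
elim: m => [|m IH]; first by rewrite big_ord0.
by rewrite big_ord_recr mulnDr IH /= -mulnn; nia.
Qed.

Lemma sum_minn2 m (F : nat -> nat) :
  \sum_(i < m.+2) F (minn 2 i) = F 0 + F 1 + m * F 2.
Proof.
rewrite !big_ord_recl /= addnA; congr (_ + _).
rewrite (eq_bigr (fun=> F 2)); first by rewrite sum_nat_const card_ord.
by move=> i _; rewrite /bump /=; congr (F _); lia.
Qed.

(** The sum of F (d + 1) over the elimination degrees d of T1 and, below, of the
    join of a triangulated polygon on l vertices with a complete graph on m
    vertices. *)
Definition T1_cost (F : nat -> nat) l t c :=
  t * F l.+1 + \sum_(i < c + l) F i.+1.
Definition T2_cost (F : nat -> nat) l m :=
  \sum_(i < l) F (minn 2 i + m).+1 + \sum_(i < m) F i.+1.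

Lemma T2_costE F l m : T2_cost F l.+2 m =
  F m.+1 + F m.+2 + l * F m.+3 + \sum_(i < m) F i.+1.
Proof. by rewrite /T2_cost (sum_minn2 l (fun d => F (d + m).+1)). Qed.

Lemma nnz_cost_lt n : 0 < n ->
  T1_cost id (8 * n) (5 * n) (4 * n) < T2_cost id (8 * n) (9 * n).
Proof.
case: n => // n _; have -> : 8 * n.+1 = (8 * n + 6).+2 by lia.
rewrite T2_costE /T1_cost /=.
set S1 := bigop.body _ _ _; set S2 := bigop.body _ _ _.
have := sum_succ (4 * n.+1 + (8 * n + 6).+2); have := sum_succ (9 * n.+1).
rewrite -/S1 -/S2; nia.
Qed.

(** The inequality fails at n = 64.  With n = k + 65 the difference is
    a polynomial in k with positive coefficients. *)
Lemma flop_cost_lt n : 64 < n ->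
  T2_cost (expn^~ 2) (8 * n) (9 * n) < T1_cost (expn^~ 2) (8 * n) (5 * n) (4 * n).
Proof.
move=> n64; have [k ->] : exists k, n = k + 65 by exists (n - 65); lia.
have -> : 8 * (k + 65) = (8 * k + 518).+2 by lia.
rewrite T2_costE /T1_cost /= -!mulnn.
set S1 := bigop.body _ _ _; set S2 := bigop.body _ _ _.
have := sum_succ_sqr (4 * (k + 65) + (8 * k + 518).+2).
have := sum_succ_sqr (9 * (k + 65)).
rewrite -/S1 -/S2; nia.
Qed.

Section Triangulations.
Variables l t c : nat.
Hypothesis l3 : 3 <= l.

Notation G := (gjoin (cycle_graph l) (gsum (edgeless 'I_t) (complete 'I_c))).
Notation T1 := (gjoin (complete 'I_l) (gsum (edgeless 'I_t) (complete 'I_c))).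
Notation T2 Cl := (gjoin Cl (complete ('I_t + 'I_c)%type)).
Notation m := (t + c).

(** The elimination degrees are 2, ..., 2, 1, 0 in the order of elimination. *)
Definition polygon (E : sgraph 'I_l) r :=
  [/\ subrel (cycle_graph l) E, peo_rank E r & forall v, updeg E r v = minn 2 (above r v)].

Lemma T1_triangulation : triangulation G T1.
Proof.
split; last exact: peo_chordal (@T1_peo l t c).
by move=> [x|u] [y|w] //= /andP [].
Qed.

Lemma T2_triangulation (Cl : sgraph 'I_l) r :
  subrel (cycle_graph l) Cl -> peo_rank Cl r -> triangulation G (T2 Cl).
Proof.
move=> subCl peo; split; last exact: peo_chordal (join_complete_peo _ peo).
by move=> [x|u] [y|w] //=; [apply: subCl | case: u w => [?|?] [?|?]].
Qed.

Lemma triangulation_cases H : triangulation G H ->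
  subrel T1 H \/ exists E r, polygon E r /\ subrel (T2 E) H.
Proof.
move=> [subH chH].
have cross x u : H (inl x) (inr u) by apply: subH.
have cross' x u : H (inr u) (inl x) by apply: subH.
case: (chordal_join chH cross) => [clL|clR].
  by left=> -[x|u] [y|w] //=; [apply: clL | move=> uw; apply: subH].
right; have [r peo] := chordal_peo chH.
have peoL := induced_peo (f := inl) (fun _ _ '(erefl) => erefl) peo.
have [|E [subE subC peoE degE]] := cycle_graph_ears l3 _ peoL.
  by move=> x y Cxy; apply: subH.
exists E, (r \o inl); split=> //.
by move=> [x|u] [y|w] //=; [apply: subE | apply: clR].
Qed.

(** Any ordering is perfect for the complete graph, so the polygon of
    [cycle_graph_ears] is found inside it. *)
Lemma polygon_exists : exists E r, polygon E r.
Proof.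
have peo : peo_rank (complete 'I_l) (@nat_of_ord l).
  by split=> [|v w x _ _ _ _ //]; exact: val_inj.
have [|E [_ subC peoE degE]] := cycle_graph_ears l3 _ peo; first by move=> x y /andP [].
by exists E, (@nat_of_ord l).
Qed.

Lemma minimal_polygon Cl : minimal_triangulation (cycle_graph l) Cl ->
  exists E r, [/\ polygon E r, subrel E Cl, subrel Cl E & peo_rank Cl r].
Proof.
move=> minCl; have [[subCl chCl] _] := minCl; have [r peo] := chordal_peo chCl.
have [E [subE subC peoE degE]] := cycle_graph_ears l3 subCl peo.
exists E, r; split=> //; apply: (minimal_triangulation_sub minCl) subE.
by split=> //; apply: peo_chordal peoE.
Qed.

Lemma sum_T2 E r F : polygon E r ->
  \sum_w F (updeg (T2 E) (join_rank r) w).+1 = T2_cost F l m.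
Proof.
move=> [_ peoE degE]; rewrite sum_join_complete card_sum !card_ord.
congr (_ + _); rewrite (eq_bigr (fun x => F (minn 2 (above r x) + m).+1)).
  by rewrite (sum_above (fun d => F (minn 2 d + m).+1)) ?card_ord; case: peoE.
by move=> x _; rewrite degE.
Qed.

Lemma T2_peo E r : polygon E r -> peo_rank (T2 E) (join_rank r).
Proof. by case=> _ peoE _; apply: join_complete_peo. Qed.

Lemma nnz_T1 : nnz T1 = T1_cost id l t c.
Proof. by rewrite (nnzE (T1_peo _ _ _)) (sum_T1 l t c id). Qed.

Lemma flop_T1 : flop T1 = T1_cost (expn^~ 2) l t c.
Proof. by rewrite (flopE (T1_peo _ _ _)) (sum_T1 l t c (expn^~ 2)). Qed.

Lemma omega_T1 : l + c <= omega T1.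
Proof.
have l0 : 0 < l by apply: leq_trans l3.
rewrite (omegaE (T1_peo _ _ _)).
apply: leq_trans (leq_bigmax (inl (Ordinal l0))); rewrite updeg_T1_inl /=; lia.
Qed.

Lemma nnz_T2 E r : polygon E r -> nnz (T2 E) = T2_cost id l m.
Proof. by move=> pE; rewrite (nnzE (T2_peo pE)) (sum_T2 id pE). Qed.

Lemma flop_T2 E r : polygon E r -> flop (T2 E) = T2_cost (expn^~ 2) l m.
Proof. by move=> pE; rewrite (flopE (T2_peo pE)) (sum_T2 (expn^~ 2) pE). Qed.

Lemma omega_T2 E r : polygon E r -> omega (T2 E) = m + 3.
Proof.
move=> pE; have [_ peoE degE] := pE; rewrite (omegaE (T2_peo pE)).
have cardB : #|{: 'I_t + 'I_c}| = m by rewrite card_sum !card_ord.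
apply/eqP; rewrite eqn_leq; apply/andP; split.
  apply/bigmax_leqP => -[x|u] _.
    by rewrite updeg_join_inl cardB degE; lia.
  rewrite updeg_join_inr.
  by apply: leq_trans (ltn_above _ u) _; rewrite cardB leq_addr.
have l0 : 0 < l by apply: leq_trans l3.
case: (@arg_minnP _ (Ordinal l0) xpredT r isT) => x _ xmin.
apply: leq_trans (leq_bigmax (inl x)).
rewrite updeg_join_inl cardB degE.
have := cardsC1 x; rewrite card_ord => cardx.
suff -> : above r x = l.-1 by lia.
rewrite -cardx; apply: eq_card => y; rewrite !inE ltn_neqAle xmin // andbT.
by rewrite eq_sym (inj_eq (proj1 peoE)).
Qed.

End Triangulations.

Theorem mainTheorem2 (n l t c : nat) (hn : 64 < n)
  (hl : l = 8 * n) (ht : t = 5 * n) (hc : c = 4 * n) :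
  let G := gjoin (cycle_graph l) (gsum (edgeless 'I_t) (complete 'I_c)) in
  let T1 := gjoin (complete 'I_l) (gsum (edgeless 'I_t) (complete 'I_c)) in
  let T2 (Cl : sgraph 'I_l) := gjoin Cl (complete ('I_t + 'I_c)%type) in
  [/\ [/\ minimizes (@nnz _) G T1,
          ~ minimizes (@flop _) G T1
        & ~ minimizes (@omega _) G T1],
      forall Cl : sgraph 'I_l, minimal_triangulation (cycle_graph l) Cl ->
        [/\ minimizes (@flop _) G (T2 Cl),
            minimizes (@omega _) G (T2 Cl)
          & ~ minimizes (@nnz _) G (T2 Cl)]
    & ~ exists H, minimizes (@nnz _) G H /\ minimizes (@flop _) G H].
Proof.
move=> G T1 T2.
have l3 : 3 <= l by lia.
have tc : t + c = 9 * n by lia.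
have nnz12 : T1_cost id l t c < T2_cost id l (t + c).
  by rewrite tc hl ht hc; apply: nnz_cost_lt; apply: leq_trans hn.
have flop21 : T2_cost (expn^~ 2) l (t + c) < T1_cost (expn^~ 2) l t c.
  by rewrite tc hl ht hc; apply: flop_cost_lt.
have omega21 : t + c + 3 < l + c by lia.
have T1peo := T1_peo l t c; have T1tri := T1_triangulation l t c.
have cases := triangulation_cases l3.
have [E0 [r0 pE0]] := polygon_exists l3.
have E0tri : triangulation G (T2 E0).
  by case: pE0 => subC peoE _; apply: T2_triangulation subC peoE.
(* T1 and the joins of polygons with K_(t+c) bound all costs from below. *)
have lower_bounds H : triangulation G H ->
    [/\ nnz T1 <= nnz H, flop T1 <= flop H & omega T1 <= omega H] \/
    [/\ T2_cost id l (t + c) <= nnz H, T2_cost (expn^~ 2) l (t + c) <= flop H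
      & t + c + 3 <= omega H].
  move=> triH; have [rH peoH] := chordal_peo (proj2 triH).
  case: (cases _ _ _ triH) => [subH|[E [r [pE subH]]]].
    by left; split; [apply: nnz_le T1peo peoH subH | apply: flop_le T1peo peoH subH
                    | apply: omega_le T1peo peoH subH].
  right; have T2peo := T2_peo t c pE.
  rewrite -(nnz_T2 t c pE) -(flop_T2 t c pE) -(omega_T2 t c l3 pE).
  by split; [apply: nnz_le T2peo peoH subH | apply: flop_le T2peo peoH subH
            | apply: omega_le T2peo peoH subH].
split; first split.
- split=> // H /lower_bounds [[] //|[le _ _]].
  by rewrite (nnz_T1 l t c); apply: leq_trans le; apply: ltnW.
- move=> [_ /(_ _ E0tri)]; rewrite (flop_T1 l t c) (flop_T2 t c pE0).
  by rewrite leqNgt flop21.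
- move=> [_ /(_ _ E0tri)]; rewrite (omega_T2 t c l3 pE0).
  by move/(leq_trans (omega_T1 t c l3)); rewrite leqNgt omega21.
- move=> Cl /(minimal_polygon l3) [E [r [pE subE subCl peoCl]]].
  have [subC _ _] := pE.
  have Cltri : triangulation G (T2 Cl).
    by apply: T2_triangulation peoCl => x y /subC /subE.
  have T2Ele : subrel (T2 Cl) (T2 E) by move=> [x|u] [y|w] //=; apply: subCl.
  have peo2 := join_complete_peo ('I_t + 'I_c)%type peoCl.
  have flopCl : flop (T2 Cl) <= T2_cost (expn^~ 2) l (t + c).
    by rewrite -(flop_T2 t c pE); exact: flop_le peo2 (T2_peo t c pE) T2Ele.
  have omegaCl : omega (T2 Cl) <= t + c + 3.
    by rewrite -(omega_T2 t c l3 pE); exact: omega_le peo2 (T2_peo t c pE) T2Ele.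
  split.
  + split=> // H /lower_bounds [[_ le _]|[_ le _]]; apply: leq_trans flopCl _ => //.
    by apply: leq_trans le; rewrite (flop_T1 l t c) ltnW.
  + split=> // H /lower_bounds [[_ _ le]|[_ _ le]]; apply: leq_trans omegaCl _ => //.
    by apply: leq_trans le; apply: leq_trans (omega_T1 t c l3); apply: ltnW.
  move=> [_ /(_ _ T1tri)]; rewrite leqNgt (nnz_T1 l t c).
  have subE2 : subrel (T2 E) (T2 Cl) by move=> [x|u] [y|w] //=; apply: subE.
  have := nnz_le (T2_peo t c pE) peo2 subE2; rewrite (nnz_T2 t c pE).
  by move/(leq_trans nnz12) => ->.
move=> [H [[triH minN] [_ minF]]].
case: (lower_bounds H triH) => [[_ le _]|[le _ _]].
  have := leq_trans le (minF _ E0tri).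
  by rewrite (flop_T1 l t c) (flop_T2 t c pE0) leqNgt flop21.
have := leq_trans le (minN _ T1tri); by rewrite (nnz_T1 l t c) leqNgt nnz12.
Qed.
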